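(* Let $d\ge 1$ and let $S \subseteq \mathbb{R}^d$ be a Meyer set. If $$\liminf_{T \to \infty} \frac{N_S(T)}{T^d} = 0,$$ then $S$ has a non-trivial annihilator. In particular, $S$ has an annihilator of the form $$(X^{\mathbf{v}_1}-1) \cdots (X^{\mathbf{v}_m}-1)$$ for some non-zero vectors $\mathbf{v}_1,\ldots,\mathbf{v}_m\in\mathbb{R}^d$.
   Context: A set $S\subseteq\mathbb{R}^d$ is uniformly discrete if there is $r>0$ such that every open Euclidean ball of radius $r$ contains at most one point of $S$, and relatively dense if there is $R>0$ such that every closed ball of radius $R$ contains at least one point of $S$. A Delone set is a set that is both. A Delone set $S$ is a Meyer set if $S-S$ is also a Delone set. With $B_T$ the closed Euclidean ball of radius $T$ centered at the origin, $N_S(T) = |\{ (S-\mathbf{s}) \cap B_T \mid \mathbf{s} \in S \}|$. An $\mathbb{R}^d$-polynomial is a finitely supported function $f\colon\mathbb{R}^d\to\mathbb{C}$, written $f=\sum_{\mathbf{u}\in\mathrm{supp}(f)} f_{\mathbf{u}}X^{\mathbf{u}}$, with $1=X^{\mathbf{0}}$. The product of an $\mathbb{R}^d$-polynomial $f$ and a function $c\colon\mathbb{R}^d\to\mathbb{C}$ (in particular, another $\mathbb{R}^d$-polynomial) is the convolution $(fc)(\mathbf{u})=\sum_{\mathbf{v}\in\mathrm{supp}(f)} f(\mathbf{v})\,c(\mathbf{u}-\mathbf{v})$. $f$ is an annihilator of $c$ if $fc=0$; it is an annihilator of a set $S$ if it annihilates the indicator function $\mathbbm{1}_S\colon\mathbb{R}^d\to\{0,1\}$.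 Non-trivial means non-zero. *)

(* Defs.v *)
From HB Require Import structures.
From mathcomp Require Import all_boot all_order all_algebra finmap.
From mathcomp Require Import all_classical all_reals all_analysis.
From mathcomp Require Import complex.

Set Implicit Arguments.
Unset Strict Implicit.
Unset Printing Implicit Defensive.

Import Order.TTheory GRing.Theory Num.Theory.
Import numFieldNormedType.Exports.

Local Open Scope classical_set_scope.
Local Open Scope ring_scope.

Section Delone.
Variables (R : realType) (d : nat).
Implicit Types (S : set 'rV[R]_d) (x : 'rV[R]_d).

(* The library's norm and balls on 'rV[R]_d are those of the sup norm, hence
   the separate Euclidean notions. *)
Definition enorm x : R := Num.sqrt (\sum_(i < d) x 0 i ^+ 2).

Definition open_eball x (r : R) : set 'rV[R]_d := [set y | enorm (y - x) < r].

Definition closed_eball x (r : R) : set 'rV[R]_d :=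
  [set y | enorm (y - x) <= r].

Definition uniformly_discrete S : Prop :=
  exists2 r : R, 0 < r &
    forall x p q, (S `&` open_eball x r) p -> (S `&` open_eball x r) q -> p = q.

Definition relatively_dense S : Prop :=
  exists2 r : R, 0 < r & forall x, S `&` closed_eball x r !=set0.

Definition delone S : Prop := uniformly_discrete S /\ relatively_dense S.

Definition difference_set S : set 'rV[R]_d := [set x - y | x in S & y in S].

Definition meyer S : Prop := delone S /\ delone (difference_set S).

Definition translate S s : set 'rV[R]_d := [set x - s | x in S].

Definition patterns S (T : R) : set (set 'rV[R]_d) :=
  [set translate S s `&` closed_eball 0 T | s in S].

(* [counting] is the number of elements, and +oo on infinite sets *)
Definition pattern_complexity S (T : R) : \bar R := counting (patterns S T).

End Delone.

Section RdPolynomials.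
Variables (R : realType) (d : nat).

Definition rdpoly := {fsfun 'rV[R]_d -> R[i] with 0}.

Implicit Types (f g : rdpoly) (c : 'rV[R]_d -> R[i]) (u v : 'rV[R]_d).

Definition conv f c : 'rV[R]_d -> R[i] :=
  fun u => \sum_(v <- finsupp f) f v * c (u - v).

Definition annihilates f c : Prop := forall u, conv f c u = 0.

Definition annihilates_set f (S : set 'rV[R]_d) : Prop := annihilates f (\1_S).

Definition monomial v : rdpoly := [fsfun u in [fset v]%fset => 1].

Definition rdpoly_sub f g : rdpoly :=
  [fsfun u in (finsupp f `|` finsupp g)%fset => f u - g u].

Lemma rdpoly_subE f g u : rdpoly_sub f g u = f u - g u.
Proof.
rewrite fsfun_fun in_fsetU; case: finsuppP => //= _.
by case: finsuppP => //= _; rewrite subr0.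
Qed.

(* The product of two polynomials vanishes outside the set of the sums v + w;
   [rdpoly_mulE] shows that it is their convolution. *)
Definition rdpoly_mul f g : rdpoly :=
  [fsfun u in [fset (v + w)%R | v in finsupp f, w in finsupp g]%fset =>
    conv f g u].

Lemma rdpoly_mulE f g : rdpoly_mul f g =1 conv f g.
Proof.
move=> u; rewrite fsfun_fun; case: ifPn => // /negP uN.
rewrite /conv big_seq big1// => v vf.
case: (finsuppP g (u - v)) => [_|uvg]; first by rewrite mulr0.
by case: uN; apply/imfset2P; exists v => //; exists (u - v); rewrite // addrC subrK.
Qed.

(* X^v - 1, where 1 = X^0 *)
Definition monomial_sub1 v : rdpoly := rdpoly_sub (monomial v) (monomial 0).

(* (X^(v_0) - 1) ... (X^(v_(m-1)) - 1) *)
Definition prod_monomial_sub1 m (v : 'I_m -> 'rV[R]_d) : rdpoly :=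
  \big[rdpoly_mul/monomial 0]_(i < m) monomial_sub1 (v i).

End RdPolynomials.

(* Main.v *)
(* Fix a large ball and pick in it L^d points A of S, L comparable to its radius
   T. As S - S is uniformly discrete, A - A has O(L^d) elements, so at least
   L^d / 2 differences v form the set D of popular ones, which are
   represented c L^d times as a - b in A. Look for a polynomial f supported on
   D: each u yields the equation sum_v f(v) 1_S(u - v) = 0. A nonzero equation
   has u = s + v with s in S and v in D; write also u = s' + w with s' in S and
   w bounded. Each representation v = a - b gives
   w = (s - b) - (s' - a) with s - b and s' - a in S - S, and counting these
   pairs bounds the number of possible w for a given s' independently of T.
   Since the equation depends only on w and on the pattern of S around s',
   there are O(N_S(T)) = o(L^d) equations, and a nonzero integer solution f
   exists.

   By Frobenius f(X^p) = f^p mod p annihilates S modulo p; the value of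
   f(X^p) 1_S is bounded by the sum of |f(v)|, so f(X^p) annihilates S for all
   large primes p, hence so does f(X^n) for P large and n = 1 + i P!, as the
   prime factors of n exceed P.
   These identities form a Vandermonde system in the X^(P! v), and elimination
   gives the product of the X^(P! (v - v0)) - 1, v in supp f distinct
   from v0. *)
Require Import Defs.
From HB Require Import structures.
From mathcomp Require Import all_boot all_order all_algebra all_field finmap.
From mathcomp Require Import all_classical all_reals all_analysis.
From mathcomp Require Import complex zify ring lra.
Import Order.TTheory GRing.Theory Num.Theory.
Import numFieldNormedType.Exports.
Local Open Scope classical_set_scope.
Local Open Scope ring_scope.
Set Implicit Arguments.
Unset Strict Implicit.
Unset Printing Implicit Defensive.

(** * Frobenius and dilation of integer annihilators *)

(** Binomial theorem by Pascal's rule, with iterates of operators in place of powers in a ring. *)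
Lemma iter_addD (M : zmodType) (A B : {additive M -> M}) (n : nat) (x : M) :
  (forall y, A (B y) = B (A y)) ->
  iter n (fun y => A y + B y) x =
  \sum_(i < n.+1) iter (n - i) A (iter i B x) *+ 'C(n, i).
Proof.
move=> AB; have iterAB k y : B (iter k A y) = iter k A (B y).
  by elim: k => //= k <-; rewrite AB.
elim: n => [|n IHn]; first by rewrite big_ord_recl big_ord0 /= bin0 addr0.
rewrite iterS IHn !raddf_sum [RHS]big_ord_recl bin0 mulr1n.
under [X in _ = _ + X]eq_bigr => i _ do rewrite lift0 subSS binS mulrnDr.
rewrite big_split /= addrA; congr +%R; last first.
  by apply: eq_bigr => i _; rewrite raddfMn iterAB.
rewrite big_ord_recl /= subn0 bin0 mulr1n; congr +%R.
rewrite [in RHS]big_ord_recr /= bin_small// mulr0n addr0.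
by apply: eq_bigr => i _; rewrite raddfMn /bump add1n -(subnSK (ltn_ord i)).
Qed.

Lemma iter_prime_addD (M : zmodType) (A B : {additive M -> M}) (p : nat)
    (x : M) :
  prime p -> (forall y : M, y *+ p = 0) -> (forall y, A (B y) = B (A y)) ->
  iter p (fun y => A y + B y) x = iter p A x + iter p B x.
Proof.
move=> pp Mp AB; rewrite iter_addD//; have := prime_gt0 pp.
case: p pp Mp => // p pp Mp _.
rewrite big_ord_recl big_ord_recr /= bin0 /bump add1n subnn binn !mulr1n.
rewrite big1 ?add0r// => i _; rewrite add1n.
have /dvdnP[k ->] : (p.+1 %| 'C(p.+1, i.+1))%N.
  by apply: prime_dvd_bin => //; rewrite /= ltnS ltn_ord.
by rewrite mulrnA Mp.
Qed.

Section Lincomb.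
Variables (G : zmodType) (K : pzRingType).
Implicit Types (c : G -> K) (l : seq (K * G)).

(** Convolution by a polynomial stored as a list of pairs (coefficient, exponent). Zero coefficients
    and repeated exponents are allowed, so reduction mod p and dilation are plain maps on lists. *)
Definition lincomb l c : G -> K := fun u => \sum_(x <- l) x.1 * c (u - x.2).

Lemma lincomb_is_zmod_morphism l : zmod_morphism (lincomb l).
Proof.
move=> c c'; apply/funext => u.
rewrite -[RHS]/(lincomb l c u - lincomb l c' u) -sumrB.
by apply: eq_bigr => x _; rewrite mulrBr.
Qed.

HB.instance Definition _ l :=
  GRing.isZmodMorphism.Build (G -> K) (G -> K) (lincomb l)
    (lincomb_is_zmod_morphism l).

End Lincomb.

Lemma lincombC (G : zmodType) (K : comPzRingType) (l l' : seq (K * G)) c :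
  lincomb l (lincomb l' c) = lincomb l' (lincomb l c).
Proof.
apply/funext => u; rewrite /lincomb.
under eq_bigr => x _ do rewrite mulr_sumr.
rewrite exchange_big; apply: eq_bigr => x _.
by rewrite mulr_sumr; apply: eq_bigr => y _; rewrite mulrCA addrAC.
Qed.

Lemma lincomb_frobenius (G : zmodType) (K : comNzRingType) (p : nat)
    (l : seq (K * G)) c :
  p \in [pchar K] ->
  iter p (lincomb l) c = lincomb [seq (x.1 ^+ p, x.2 *+ p) | x <- l] c.
Proof.
move=> pK; have pp := pcharf_prime pK.
have Mp (c' : G -> K) : c' *+ p = 0.
  by apply/funext => u; rewrite natmulfctE /= -mulr_natr (pcharf0 pK) mulr0.
elim: l c => [|x l IHl] c.
  rewrite -(prednK (prime_gt0 pp)) iterS.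
  by apply/funext => u; rewrite /lincomb !big_nil.
have -> : lincomb (x :: l) = fun c => lincomb [:: x] c + lincomb l c.
  apply/funext => c'; apply/funext => u.
  by rewrite fctE /lincomb big_cons big_seq1.
rewrite iter_prime_addD//; last by move=> c'; exact: lincombC.
rewrite IHl; apply/funext => u.
rewrite fctE [RHS]/lincomb big_cons -/(lincomb _ _ _); congr +%R.
elim: {IHl Mp pp pK}p u => [|p IHp] u.
  by rewrite expr0 mul1r mulr0n subr0.
by rewrite /= {1}/lincomb big_seq1 /= IHp mulrA -exprS mulrS opprD addrA.
Qed.

(** Modulo [p] the dilated operator is the [p]-th iterate of the original one and kills [c]. The
    value is thus a multiple of [p], and it is bounded by the coefficient sum, which is less than
    [p]. *)
Lemma lincomb_prime_dilation (G : zmodType) (l : seq (int * G)) (c : G -> int)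
    (p : nat) :
  prime p -> \sum_(x <- l) `|x.1| < p%:Z -> (forall u, `|c u| <= 1) ->
  lincomb l c =1 cst 0 ->
  lincomb [seq (x.1, x.2 *+ p) | x <- l] c =1 cst 0.
Proof.
move=> pp lp c1 lc u; have pK := pchar_Fp pp.
pose r (z : int) : 'F_p := z%:~R.
have rM (l' : seq (int * G)) c' u' :
    r (lincomb l' c' u') = lincomb [seq (r x.1, x.2) | x <- l'] (r \o c') u'.
  rewrite /lincomb big_map /r rmorph_sum.
  by apply: eq_bigr => x _; rewrite rmorphM.
have /eqP : r (lincomb [seq (x.1, x.2 *+ p) | x <- l] c u) = 0.
  rewrite rM.
  have -> : [seq (r x.1, x.2) | x <- [seq (x.1, x.2 *+ p) | x <- l]] =
      [seq (x.1 ^+ p, x.2 *+ p) | x <- [seq (r x.1, x.2) | x <- l]].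
    rewrite -!map_comp; apply: eq_map => x /=; congr pair.
    (* Fermat: taking [p]-th powers leaves coefficients in ['F_p] unchanged. *)
    by have := expf_card (r x.1); rewrite card_Fp.
  rewrite -(lincomb_frobenius _ _ pK).
  have lrc : lincomb [seq (r x.1, x.2) | x <- l] (r \o c) = 0.
    by apply/funext => v; rewrite -rM lc.
  suff it0 n : (0 < n)%N ->
      iter n (lincomb [seq (r x.1, x.2) | x <- l]) (r \o c) = 0.
    by rewrite it0// prime_gt0.
  by case: n => // n _; rewrite iterSr lrc; elim: n => //= n ->; rewrite raddf0.
rewrite -(dvdz_pcharf pK) => /dvdzP[q e]; apply/eqP.
apply: contraTT lp => nz; rewrite -leNgt.
have le1 : `|lincomb [seq (x.1, x.2 *+ p) | x <- l] c u| <=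
    \sum_(x <- l) `|x.1|.
  rewrite /lincomb big_map (le_trans (ler_norm_sum _ _ _))//.
  by apply: ler_sum => x _; rewrite normrM ler_piMr.
apply: le_trans le1; rewrite e normrM ler_peMl//.
rewrite -gtz0_ge1 normr_gt0; apply: contraNneq nz => q0.
by rewrite e q0 mul0r.
Qed.

(** Prime factors of [n] are peeled off one by one; dilation keeps the coefficients, hence the bound
    on them. *)
Lemma lincomb_dilation (G : zmodType) (l : seq (int * G)) (c : G -> int)
    (n : nat) :
  (0 < n)%N ->
  (forall p, prime p -> (p %| n)%N -> \sum_(x <- l) `|x.1| < p%:Z) ->
  (forall u, `|c u| <= 1) -> lincomb l c =1 cst 0 ->
  lincomb [seq (x.1, x.2 *+ n) | x <- l] c =1 cst 0.
Proof.
move=> + + c1 lc; elim/ltn_ind: n => n IHn n0 pn.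
have [n1|n1] := leqP n 1.
  have -> : n = 1%N by apply/eqP; rewrite eqn_leq n1.
  by rewrite (eq_map (g := id)) ?map_id//; case.
have pp := pdiv_prime n1; have /dvdnP[k nE] := pdiv_dvd n.
have k0 : (0 < k)%N by move: n0; rewrite nE muln_gt0 => /andP[].
have kn : (k < n)%N by rewrite [ltnRHS]nE ltn_Pmulr// prime_gt1.
have {}IHn : lincomb [seq (x.1, x.2 *+ k) | x <- l] c =1 cst 0.
  by apply: IHn => // q qp qk; apply: pn; rewrite // nE dvdn_mulr.
have -> : [seq (x.1, x.2 *+ n) | x <- l] =
   [seq (x.1, x.2 *+ pdiv n) | x <- [seq (x.1, x.2 *+ k) | x <- l]].
  by rewrite -map_comp; apply: eq_map => x /=; rewrite -mulrnA -nE.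
by apply: lincomb_prime_dilation; rewrite // big_map pn// pdiv_dvd.
Qed.

(** * Elimination down to a product of differences *)

Lemma prime_dvdn_factD1 (P i p : nat) :
  prime p -> (p %| 1 + i * P`!)%N -> (P < p)%N.
Proof.
move=> pp pd; rewrite ltnNge; apply/negP => pP.
have : (p %| i * P`!)%N by rewrite dvdn_mull// dvdn_fact// prime_gt0.
by move=> /(dvdn_addl 1%N); rewrite pd dvdn1 => /esym/eqP p1; rewrite p1 in pp.
Qed.

(** The operator X^v - 1. *)
Definition shift_diff (G K : zmodType) (v : G) (c : G -> K) : G -> K :=
  fun u => c (u - v) - c u.

Lemma foldr_shift_diffC (G K : zmodType) (s : seq G) v (c : G -> K) :
  foldr (@shift_diff G K) (shift_diff v c) s =
  shift_diff v (foldr (@shift_diff G K) c s).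
Proof.
elim: s => //= w s ->; apply/funext => u; rewrite /shift_diff.
by rewrite [u - w - v]addrAC !opprB addrACA [RHS]addrACA; congr +%R; exact: addrC.
Qed.

(* Eliminating the last term of a Vandermonde system by the commuting operators
   X^v - X^w replaces the determinant argument. *)
Lemma vandermonde_elimination (G K : zmodType) (s : seq (G * (G -> K))) c :
  (forall i u, c u + \sum_(x <- s) x.2 (u - x.1 *+ i) = 0) ->
  foldr (@shift_diff G K) c (map fst s) =1 cst 0.
Proof.
elim: {s}(size s) {-2}s (erefl (size s)) c => [|n IHn] [|[v b] s]//= ss c cs u.
  by have := cs 0%N u; rewrite big_nil addr0.
rewrite -foldr_shift_diffC.
(* Equation [i] shifted by [v] minus equation [i.+1] cancels the term of [v]; every other function
   gets multiplied by X^v - X^(x.1). *)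
pose s' := [seq (x.1, fun u => x.2 (u - v) - x.2 (u - x.1)) | x <- s].
have -> : map fst s = map fst s' by rewrite /s' -map_comp.
apply: IHn => [|i {}u]; first by rewrite size_map; case: ss.
rewrite big_map /= sumrB.
have uS w : u - w *+ i.+1 = u - w *+ i - w by rewrite mulrSr opprD addrA.
have /eqP : c (u - v) +
    (b (u - v *+ i - v) + \sum_(x <- s) x.2 (u - x.1 *+ i - v)) = 0.
  rewrite -[RHS](cs i (u - v)) big_cons /= [u - v - _]addrAC.
  by congr (_ + (_ + _)); apply: eq_bigr => x _; rewrite addrAC.
have /eqP : c u +
    (b (u - v *+ i - v) + \sum_(x <- s) x.2 (u - x.1 *+ i - x.1)) = 0.
  rewrite -[RHS](cs i.+1 u) big_cons /= uS.
  by congr (_ + (_ + _)); apply: eq_bigr => x _; rewrite uS.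
rewrite /shift_diff !addr_eq0 => /eqP -> /eqP ->.
rewrite opprK [- _ + _]addrC opprD [X in X + _]addrACA subrr add0r.
by rewrite -[X in X + _]opprB addNr.
Qed.

Lemma foldr_shift_diff_affine (G : zmodType) (K : pzRingType) (s : seq G) a w
    (c : G -> K) u :
  foldr (@shift_diff G K) (fun u => a * c (u - w)) s u =
  a * foldr (@shift_diff G K) c s (u - w).
Proof.
elim: s u => //= v s IHs u.
by rewrite {1}/shift_diff !IHs -mulrBr [u - v - w]addrAC.
Qed.

(** Dilating by 1 + i P! and translating by i P! [x0.2] freezes the term of [x0] and moves the
    others by i P! (x.2 - x0.2), the shape that elimination needs. Torsion-freeness keeps these
    vectors non-zero. *)
Lemma lincomb_annihilator_diff (G : zmodType) (l : seq (int * G)) (x0 : int * G)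
    (c : G -> int) :
  (forall (v : G) n, v != 0 -> v *+ n.+1 != 0) ->
  x0.1 != 0 -> x0.2 \notin map snd l ->
  (forall u, `|c u| <= 1) -> lincomb (x0 :: l) c =1 cst 0 ->
  exists2 s : seq G, 0 \notin s & foldr (@shift_diff G int) c s =1 cst 0.
Proof.
move=> tfree x00 x0l c1 lc; set P := `|(\sum_(x <- x0 :: l) `|x.1|)%R|%N.
have P0 := fact_gt0 P.
pose s := [seq ((x.2 - x0.2) *+ P`!, fun u => x.1 * c (u - x.2)) | x <- l].
exists (map fst s).
  apply/negP; rewrite -map_comp => /mapP[x xl /esym/eqP /=]; apply/negP.
  rewrite -(prednK P0); apply/tfree; rewrite subr_eq0.
  by apply: contraNneq x0l => <-; apply: map_f.
pose c0 u := x0.1 * c (u - x0.2).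
suff c0s : foldr (@shift_diff G int) c0 (map fst s) =1 cst 0.
  move=> u; have := c0s (u + x0.2); rewrite /c0 foldr_shift_diff_affine addrK.
  by move=> /eqP; rewrite mulf_eq0 (negPf x00) => /eqP.
apply: vandermonde_elimination => i u.
have ni p : prime p -> (p %| 1 + i * P`!)%N ->
    \sum_(x <- x0 :: l) `|x.1| < p%:Z.
  move=> pp /(prime_dvdn_factD1 pp) Pp.
  have <- : P%:Z = \sum_(x <- x0 :: l) `|x.1|.
    by rewrite gez0_abs//; apply: sumr_ge0.
  by rewrite ltz_nat.
have /= := lincomb_dilation (ltn0Sn _) ni c1 lc (u + x0.2 *+ (i * P`!)).
rewrite /lincomb big_map big_cons /cst /= => e; rewrite -[RHS]e; congr +%R.
  by rewrite /c0 mulrS opprD addrA addrAC addrK.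
rewrite !big_map; apply: eq_bigr => x _ /=; congr (_ * c _).
rewrite -mulrnA (mulnC _ i) mulrnBl opprB -addrA -[RHS]addrA; congr +%R.
by rewrite -addrA; congr +%R; rewrite mulrS opprD addrC.
Qed.

(** * Integer kernels and popular differences *)

(** A rational solution exists by rank; multiplying it by all the denominators makes it integral. *)
Lemma exists_int_kernel (n : nat) (rows : seq {ffun 'I_n -> int}) :
  (size rows < n)%N ->
  exists2 a : 'I_n -> int, (exists j, a j != 0) &
    forall r, r \in rows -> \sum_j a j * r j = 0.
Proof.
move=> mn; set m := size rows in mn.
pose M : 'M[rat]_(n, m) := \matrix_(j, i) (nth [ffun=> 0] rows i j)%:~R.
have kM : kermx M != 0.
  by rewrite kermx_eq0 /row_free neq_ltn (leq_ltn_trans (rank_leq_col M)).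
have /rowV0Pn[v /sub_kermxP vM v0] := kM.
pose a j := numq (v 0 j) * \prod_(k | k != j) denq (v 0 k).
have aE j : (a j)%:~R = v 0 j * (\prod_k denq (v 0 k))%:~R.
  by rewrite [in RHS](bigD1 j)//= !rmorphM /= numqE mulrA.
exists a.
  have /rV0Pn[j vj] := v0; exists j.
  by rewrite mulf_neq0// ?numq_eq0//; apply/prodf_neq0 => k _; apply: denq_neq0.
move=> r /(nthP [ffun=> 0])[i im <-].
apply/eqP; rewrite -(intr_eq0 rat) rmorph_sum /=; apply/eqP.
transitivity ((v *m M) 0 (Ordinal im) * (\prod_k denq (v 0 k))%:~R); last first.
  by rewrite vM mxE mul0r.
rewrite mxE mulr_suml; apply: eq_bigr => j _.
by rewrite rmorphM /= aE mxE mulrAC.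
Qed.

Lemma leq_sum_size (T : eqType) (s : seq T) (F : T -> nat) k :
  {in s, forall x, (F x <= k)%N} -> (\sum_(x <- s) F x <= size s * k)%N.
Proof.
move=> Fk; rewrite -sum1_size big_distrl /= big_seq [leqRHS]big_seq.
by apply: leq_sum => x /Fk; rewrite mul1n.
Qed.

Definition differences (G : zmodType) (A : seq G) : seq G :=
  undup [seq a - b | a <- A, b <- A].

Section Popular.
Variables (G : zmodType) (A : seq G) (m : nat).
Local Notation n := (size A).

Definition repr_count (v : G) := count (fun a => a - v \in A) A.

(** For a duplicate-free [A] with [m] differences the mean count is n^2 / m; the threshold is half
    of it. *)
Definition popular_differences :=
  [seq v <- differences A | (n ^ 2 <= 2 * m * repr_count v)%N].

(** Unpopular differences account for at most half of the n^2 pairs, and each popular one for at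
    most n pairs. *)
Lemma size_popular_differences :
  uniq A -> (size (differences A) <= m)%N ->
  (n <= 2 * size popular_differences)%N.
Proof.
move=> Au; set B := differences A => Bm; have [->//|n0] := posnP n.
have nsum : (n * n <= \sum_(v <- B) repr_count v)%N.
  rewrite /repr_count; under eq_bigr => v _ do rewrite -sum1_count big_mkcond /=.
  rewrite exchange_big /= -[n in (n * _)%N]sum1_size big_distrl /=.
  rewrite big_seq [leqRHS]big_seq; apply: leq_sum => a aA; rewrite mul1n.
  rewrite -big_mkcond sum1_count -size_filter -(size_map (fun b => a - b) A).
  apply: uniq_leq_size; first by rewrite map_inj_uniq// => x y /addrI/oppr_inj.
  move=> _ /mapP[b bA ->]; rewrite mem_filter /= opprB addrC subrK bA.
  by rewrite mem_undup; apply: allpairs_f.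
have m0 : (0 < m)%N.
  case: m Bm => //; rewrite leqn0 size_eq0 => /eqP B0.
  by move: nsum; rewrite B0 big_nil leqn0 muln_eq0 orbb (negPf (lt0n_neq0 n0)).
have : (2 * m * (n * n) <=
    size popular_differences * (2 * m * n) + m * n ^ 2)%N.
  have /leq_trans : (2 * m * (n * n) <= \sum_(v <- B) 2 * m * repr_count v)%N.
    by rewrite -big_distrr leq_mul2l nsum orbT.
  apply; rewrite (bigID (fun v => n ^ 2 <= 2 * m * repr_count v)%N)/=.
  rewrite -big_filter -[X in (_ + X)%N]big_filter; apply: leq_add.
    by apply: leq_sum_size => v _; rewrite leq_mul2l count_size orbT.
  apply: (@leq_trans
    (size [seq v <- B | ~~ (n ^ 2 <= 2 * m * repr_count v)%N] * n ^ 2)).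
    by apply: leq_sum_size => v; rewrite mem_filter -ltnNge => /andP[/ltnW].
  by rewrite leq_mul2r (leq_trans _ Bm) ?orbT// size_filter count_size.
move: (size popular_differences) => D H.
have : (m * n * n <= m * n * (2 * D))%N by lia.
by rewrite leq_pmul2l// muln_gt0 m0.
Qed.

(** Double counting of the pairs (w, a) with [a] and [a - v] in [A], where [v] is a popular
    difference chosen for [w]. Each [w] has at least n^2 / (2 m) such [a]. For a fixed [a], the
    points s - a + w = (s + w - v) - (a - v) lie in S - S and in a translate of [N], so there are at
    most [K]. *)
Lemma popular_translates (K : nat) (S N : set G) (s : G) (W : seq G) :
  (0 < n)%N -> uniq W -> {in A, forall a, S a} ->
  {in W, forall w, N w /\
    exists2 v, v \in popular_differences & S (s + w - v)} ->
  (forall (q : G) (P : seq G), uniq P ->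
    {in P, forall p, N (p - q) /\
      exists2 x, S x & exists2 y, S y & p = x - y} ->
    (size P <= K)%N) ->
  (size W * n <= 2 * m * K)%N.
Proof.
move=> n0 Wu AS WS NK.
have /choice[v vP] : forall w, exists v, w \in W ->
    v \in popular_differences /\ S (s + w - v).
  move=> w; have [wW|_] := boolP (w \in W); last by exists 0.
  by have [_ [v vD Sv]] := WS _ wW; exists v.
have : (size W * n ^ 2 <= 2 * m * (n * K))%N.
  apply: (@leq_trans (2 * m * \sum_(w <- W) repr_count (v w))).
    rewrite -[size W]sum1_size big_distrl big_distrr /= big_seq [leqRHS]big_seq.
    apply: leq_sum => w /vP[+ _]; rewrite mem_filter => /andP[+ _].
    by rewrite mul1n.
  rewrite leq_mul2l; apply/orP; right.
  rewrite /repr_count; under eq_bigr => w _ do rewrite -sum1_count big_mkcond /=.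
  rewrite exchange_big /=; apply: leq_sum_size => a aA.
  rewrite -big_mkcond sum1_count -size_filter -(size_map (fun w => s - a + w)).
  apply: (NK (s - a)); first by rewrite map_inj_uniq ?filter_uniq//; exact: addrI.
  move=> _ /mapP[w + ->]; rewrite mem_filter => /andP[aw wW].
  split; first by rewrite addrC addKr; have [] := WS _ wW.
  exists (s + w - v w); first by have [] := vP _ wW.
  exists (a - v w); first exact: AS.
  by rewrite opprB addrA subrK addrAC.
move=> H; have : (size W * n * n <= 2 * m * K * n)%N by lia.
by rewrite leq_pmul2r.
Qed.

End Popular.

(** * Counting the equations *)

(** A duplicate-free list of maximal length in [X] exhausts it. *)
Lemma bounded_enum (T : choiceType) (X : set T) (K : nat) :
  (forall s : seq T, uniq s -> {in s, forall x, X x} -> (size s <= K)%N) ->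
  exists2 s : seq T, (size s <= K)%N & forall x, X x -> x \in s.
Proof.
move=> XK.
pose P k := `[< exists2 s : seq T, uniq s /\ {in s, forall x, X x} & size s = k >].
have P0 : exists k, P k by exists 0%N; apply/asboolP; exists [::].
have PK k : P k -> (k <= K)%N by move=> /asboolP[s [su sX] <-]; apply: XK.
case: (ex_maxnP P0 PK) => k /asboolP[s [su sX] sk] kmax.
exists s => [|x Xx]; first exact: XK.
apply/negPn/negP => xs; have := kmax (size s).+1.
rewrite -sk ltnn => /(_ _)/negP; apply => //.
apply/asboolP; exists (x :: s) => //; split=> [|y]; rewrite /= ?xs// inE.
by move=> /predU1P[->|/sX].
Qed.

(** [N] is the window of the bounded vectors [w], [reps] lists centres representing all patterns,
    and [K] bounds the number of non-zero equations per centre. The unknowns, indexed by [D], then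
    outnumber the equations. *)
Lemma exists_int_annihilator (G : zmodType) (S N : set G) (D reps : seq G)
    (K : nat) :
  uniq D -> (forall u, exists2 s, S s & N (u - s)) ->
  (forall s, S s -> exists2 s1, s1 \in reps &
    forall w v, N w -> v \in D -> S (s + w - v) <-> S (s1 + w - v)) ->
  (forall s W, uniq W ->
    {in W, forall w, N w /\ exists2 v, v \in D & S (s + w - v)} ->
    (size W <= K)%N) ->
  (size reps * K < size D)%N ->
  exists l : seq (int * G),
    [/\ l != [::], uniq (map snd l), {in l, forall x, x.1 != 0} &
      lincomb l (fun u => (u \in S)%:R) =1 cst 0].
Proof.
move=> Du Scov Srep SW DK.
have /choice[Ws WsP] : forall s, exists Ws : seq G, (size Ws <= K)%N /\
    forall w, N w /\ (exists2 v, v \in D & S (s + w - v)) -> w \in Ws.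
  move=> s; have [|Ws WK WP] := @bounded_enum _
    [set w | N w /\ exists2 v, v \in D & S (s + w - v)] K; last by exists Ws.
  by move=> W Wu WP; apply: (SW s).
pose row u := [ffun j : 'I_(size D) => ((u - D`_j \in S)%:R : int)].
pose rows := [seq row (s + w) | s <- reps, w <- Ws s].
have [|a [j0 aj0] aP] := @exists_int_kernel _ rows.
  apply: leq_ltn_trans DK; rewrite size_allpairs_dep sumnE big_map.
  by apply: leq_sum_size => s _; have [] := WsP s.
exists [seq (a j, D`_j) | j <- enum 'I_(size D) & a j != 0]; split.
- have j0D : j0 \in [seq j <- enum 'I_(size D) | a j != 0].
    by rewrite mem_filter aj0 mem_enum.
  by rewrite -size_eq0 size_map size_eq0; apply: contraTneq j0D => ->.
- rewrite -map_comp map_inj_in_uniq ?filter_uniq// -?enumT ?enum_uniq//.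
  move=> j k _ _ /= /eqP.
  by rewrite nth_uniq// => /eqP/val_inj.
- by move=> _ /mapP[j + ->]; rewrite mem_filter => /andP[].
move=> u; transitivity (\sum_j a j * row u j).
  rewrite /lincomb big_map big_filter big_enum_cond/= big_mkcond /=.
  apply: eq_bigr => j _; rewrite ffunE.
  by case: eqVneq => //= ->; rewrite mul0r.
(* If no u - v with v in [D] lies in [S], the equation at [u] is trivial. Otherwise, replacing a
   centre [s] near [u] by its representative [s1] keeps the row, which is therefore listed. *)
have [[j uj]|row0] := pselect (exists j : 'I_(size D), S (u - D`_j)); last first.
  apply: big1 => j _; rewrite ffunE memNset ?mulr0//.
  by apply: contra_not row0 => uj; exists j.
have [s Ss us] := Scov u; have [s1 s1r s1P] := Srep _ Ss.
have uE v : v \in D -> S (u - v) <-> S (s1 + (u - s) - v).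
  by move=> vD; rewrite -s1P// [s + _]addrC subrK.
have -> : row u = row (s1 + (u - s)).
  apply/ffunP => k; rewrite !ffunE; congr (nat_of_bool _)%:R.
  by apply/idP/idP; rewrite !in_setE; apply uE; apply: mem_nth.
apply/aP/allpairs_f_dep => //; have [_] := WsP s1; apply; split => //.
by exists D`_j; [exact: mem_nth|apply/uE => //; exact: mem_nth].
Qed.

(** * Convolution and products of polynomials *)

Local Notation conv := Defs.conv.

Section Convolution.
Variables (R : realType) (d : nat).
Implicit Types (f g : rdpoly R d) (c : 'rV[R]_d -> R[i]) (u v : 'rV[R]_d).

(** Cancellation can shrink supports, so sums are taken over any convenient list containing them. *)
Lemma conv_supersupport f c u (s : seq 'rV[R]_d) :
  uniq s -> {subset finsupp f <= s} ->
  conv f c u = \sum_(v <- s) f v * c (u - v).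
Proof.
move=> su fs; rewrite /conv.
rewrite [RHS](bigID (fun v => v \in finsupp f))/=.
rewrite [X in _ + X]big1 ?addr0; last first.
  by move=> v /fsfun_dflt ->; rewrite mul0r.
rewrite -[RHS]big_filter; apply/perm_big/uniq_perm.
- exact: fset_uniq.
- exact: filter_uniq.
by move=> v; rewrite mem_filter andb_idr// => /fs.
Qed.

Lemma conv_mul f g c : conv (rdpoly_mul f g) c =1 conv f (conv g c).
Proof.
move=> u; pose s := [fset (v + w)%R | v in finsupp f, w in finsupp g]%fset.
have fgs : {subset finsupp (rdpoly_mul f g) <= s} by apply/fsubsetP/finsupp_sub.
rewrite (conv_supersupport c u (fset_uniq s) fgs).
under eq_bigr => w _ do rewrite rdpoly_mulE /conv mulr_suml.
rewrite exchange_big /conv big_seq [RHS]big_seq; apply: eq_bigr => v vf.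
rewrite -/(conv g c (u - v)) (@conv_supersupport _ _ _ [seq w - v | w <- s]).
- rewrite big_map mulr_sumr; apply: eq_bigr => w _.
  by rewrite -mulrA opprB addrA subrK.
- by rewrite map_inj_uniq ?fset_uniq//; exact: addIr.
move=> w wg; apply/mapP; exists (v + w); last by rewrite addrAC subrr add0r.
by apply/imfset2P; exists v => //; exists w.
Qed.

Lemma conv_monomial0 c : conv (monomial 0) c =1 c.
Proof.
move=> u; rewrite (@conv_supersupport _ _ _ [:: 0])//.
  by rewrite big_seq1 fsfun_fun inE eqxx mul1r subr0.
move=> v; apply: contraTT; rewrite mem_finsupp negbK fsfun_fun !inE.
by move=> /negPf ->.
Qed.

Lemma conv_monomial_sub1 v c : v != 0 ->
  conv (monomial_sub1 v) c =1 shift_diff v c.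
Proof.
move=> v0 u; rewrite (@conv_supersupport _ _ _ [:: v; 0])/=.
- rewrite big_cons big_seq1 !rdpoly_subE !fsfun_fun !inE !eqxx (negPf v0).
  by rewrite (eq_sym 0) (negPf v0) subr0 sub0r mul1r mulN1r subr0.
- by rewrite !inE v0.
move=> w; apply: contraTT; rewrite !inE negb_or => /andP[wv w0].
by rewrite mem_finsupp negbK rdpoly_subE !fsfun_fun !inE (negPf wv) (negPf w0) subrr.
Qed.

Lemma conv_prod_monomial_sub1 (s : seq 'rV[R]_d) c : 0 \notin s ->
  conv (prod_monomial_sub1 (fun i : 'I_(size s) => s`_i)) c =1
  foldr (@shift_diff _ _) c s.
Proof.
rewrite /prod_monomial_sub1 => s0 u.
(* The product over ordinals becomes one over the list, ready for induction. *)
rewrite -(big_mkord xpredT (fun i => monomial_sub1 s`_i)).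
rewrite -(big_nth 0 xpredT (@monomial_sub1 R d)).
elim: s s0 u => [|v s IHs] /=; first by rewrite big_nil => _; exact: conv_monomial0.
rewrite inE eq_sym negb_or => /andP[v0 s0] u.
rewrite big_cons conv_mul conv_monomial_sub1// /shift_diff.
by rewrite !IHs.
Qed.

Definition int_rdpoly (l : seq (int * 'rV[R]_d)) : rdpoly R d :=
  [fsfun v in [fset x.2 | x in l]%fset => (\sum_(x <- l | x.2 == v) x.1)%:~R].

Lemma int_rdpolyE l x : uniq (map snd l) -> x \in l -> int_rdpoly l x.2 = x.1%:~R.
Proof.
move=> lu xl; rewrite fsfun_fun ifT; last by apply/imfsetP; exists x.
congr _%:~R; elim: l lu xl => //= y l IHl /andP[yl lu].
rewrite inE big_cons => /predU1P[->|xl].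
  rewrite eqxx big_seq_cond big1 ?addr0// => z /andP[zl /eqP zx].
  by move: yl; rewrite -zx map_f.
rewrite IHl//; case: eqP => // yx; by move: yl; rewrite yx map_f.
Qed.

Lemma conv_int_rdpoly l (c : 'rV[R]_d -> int) u : uniq (map snd l) ->
  conv (int_rdpoly l) (fun v => (c v)%:~R) u = (lincomb l c u)%:~R.
Proof.
move=> lu; rewrite (@conv_supersupport _ _ _ (map snd l))//.
  rewrite big_map /lincomb rmorph_sum big_seq [RHS]big_seq; apply: eq_bigr => x xl.
  by rewrite rmorphM int_rdpolyE.
by move=> v /(fsubsetP (finsupp_sub _ _ _)) /imfsetP[x xl ->]; apply: map_f.
Qed.

Lemma foldr_shift_diff_intr (s : seq 'rV[R]_d) (c : 'rV[R]_d -> int) u :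
  foldr (@shift_diff _ _) (fun v => (c v)%:~R : R[i]) s u =
  (foldr (@shift_diff _ _) c s u)%:~R.
Proof. by elim: s u => //= v s IHs u; rewrite {1}/shift_diff !IHs -rmorphB. Qed.

End Convolution.

(** * Packings, grids and patterns *)

Section Cubes.
Variables (R : realType) (d : nat).
Implicit Types (S X : set 'rV[R]_d) (x : 'rV[R]_d).

(** The sup-norm ball, where packings and grids reduce to single coordinates; comparison with the
    Euclidean norm costs a factor [d]. *)
Definition cube (r : R) : set 'rV[R]_d := [set x | forall i, `|x 0 i| <= r].

Lemma cube_enorm x r : enorm x <= r -> cube r x.
Proof.
move=> xr i; apply: le_trans xr; rewrite -sqrtr_sqr ler_wsqrtr//.
by rewrite (bigD1 i)//= lerDl sumr_ge0// => j _; rewrite sqr_ge0.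
Qed.

Lemma enorm_cube x r : 0 <= r -> cube r x -> enorm x <= d%:R * r.
Proof.
move=> r0 xr; have dr0 : 0 <= d%:R * r by rewrite mulr_ge0.
rewrite -[leRHS]ger0_norm// -sqrtr_sqr ler_wsqrtr//.
apply: (@le_trans _ _ (\sum_(i < d) r ^+ 2)).
  by apply: ler_sum => i _; rewrite -real_normK ?num_real// lerXn2r// nnegrE.
rewrite sumr_const card_ord -[r ^+ 2 *+ d]mulr_natl exprMn ler_wpM2r ?sqr_ge0//.
by rewrite -natrX ler_nat; case: (d) => // n; rewrite leq_pmulr.
Qed.

Lemma uniformly_discrete_cube X : uniformly_discrete X ->
  exists2 e : R, 0 < e & forall p q, X p -> X q -> cube e (p - q) -> p = q.
Proof.
(* Dividing by [d.+1] rather than [d] yields the strict inequality of the open ball. *)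
move=> [r r0 Xr]; exists (r / d.+1%:R) => [|p q Xp Xq pq]; first by rewrite divr_gt0.
apply: (Xr q) => //; split => //.
  apply: le_lt_trans (enorm_cube _ pq) _; first by rewrite divr_ge0// ltW.
  by rewrite mulrCA gtr_pMr// ltr_pdivrMr// mul1r ltr_nat.
rewrite /open_eball /= subrr; apply: le_lt_trans (enorm_cube (lexx 0) _) _.
  by move=> i; rewrite mxE normr0.
by rewrite mulr0.
Qed.

(** The cube is cut into cells of side [e], at most [M] per coordinate; two points of [X] in the
    same cell coincide. *)
Lemma cube_packing X (e rho : R) (M : nat) (q : 'rV[R]_d) (s : seq 'rV[R]_d) :
  0 < e -> 0 <= rho -> (forall x y, X x -> X y -> cube e (x - y) -> x = y) ->
  2 * rho / e < M%:R -> uniq s -> {in s, forall x, cube rho (x - q) /\ X x} ->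
  (size s <= M ^ d)%N.
Proof.
move=> e0 rho0 Xe; case: M => [|M] rhoM su sX.
  by rewrite ltNge divr_ge0 ?(ltW e0)// mulr_ge0 in rhoM.
pose t (x : 'rV[R]_d) i := (x 0 i - q 0 i + rho) / e.
pose f x : {ffun 'I_d -> 'I_M.+1} := [ffun i => inord (Num.truncn (t x i))].
have tE x i : x \in s -> 0 <= t x i /\ f x i = Num.truncn (t x i) :> nat.
  move=> /sX[/(_ i) + _]; rewrite !mxE ler_norml => /andP[xl xr].
  have t0 : 0 <= t x i by rewrite divr_ge0 ?(ltW e0)//; lra.
  split=> //; rewrite ffunE inordK// truncn_lt_nat//.
  apply: le_lt_trans rhoM; rewrite ler_pM2r ?invr_gt0//; lra.
have fI : {in s &, injective f}.
  move=> x y xs ys fxy; have [[_ Xx] [_ Xy]] := (sX _ xs, sX _ ys).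
  apply: Xe => // i; rewrite !mxE.
  have [[tx0 fx] [ty0 fy]] := (tE x i xs, tE y i ys).
  have xyE : x 0 i - y 0 i = (t x i - t y i) * e.
    by rewrite /t -mulrBl divfK ?gt_eqF//; ring.
  rewrite xyE normrM (gtr0_norm e0) ler_piMl ?(ltW e0)//.
  have /andP[x1 x2] := truncn_itv tx0; have /andP[y1 y2] := truncn_itv ty0.
  move: x1 x2 y1 y2; rewrite -fx -fy fxy -natr1 ler_norml; lra.
have <- : #|{ffun 'I_d -> 'I_M.+1}| = (M.+1 ^ d)%N by rewrite card_ffun !card_ord.
by rewrite -(size_map f) -(card_uniqP _) ?max_card// map_inj_in_uniq.
Qed.

(** A point of [S] is chosen within [r] of each point of a grid of step 3r. As 3r > 2r the choices
    are distinct, and their differences have coordinates at most 3r(L - 1) + 2r. *)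
Lemma cube_grid S (r : R) (L : nat) :
  0 < r -> (forall x, exists2 s, S s & cube r (s - x)) -> (0 < L)%N ->
  exists A : seq 'rV[R]_d, [/\ uniq A, size A = (L ^ d)%N,
    {in A, forall a, S a} &
    {in A &, forall a b, cube (3 * r * L%:R) (a - b)}].
Proof.
move=> r0 Sr L0; have /choice[h hP] : forall g : {ffun 'I_d -> 'I_L},
    exists s, S s /\ cube r (s - \row_i (3 * r * (g i)%:R)).
  by move=> g; have [s] := Sr (\row_i (3 * r * (g i)%:R)); exists s.
have hI : injective h.
  move=> g g' gg'; apply/ffunP => i; apply/val_inj => /=.
  have [[_ /(_ i) +] [_ /(_ i) +]] := (hP g, hP g').
  rewrite gg' !mxE !ler_norml => /andP[a1 a2] /andP[b1 b2].
  have le1 : (g i)%:R * 3 <= (g' i)%:R * 3 + 2 :> R by rewrite -(ler_pM2r r0); lra.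
  have le2 : (g' i)%:R * 3 <= (g i)%:R * 3 + 2 :> R by rewrite -(ler_pM2r r0); lra.
  move: le1 le2; rewrite -!natrM -!natrD !ler_nat; lia.
exists (map h (enum {ffun 'I_d -> 'I_L})); split.
- by rewrite map_inj_uniq ?enum_uniq.
- by rewrite size_map -cardE card_ffun !card_ord.
- by move=> _ /mapP[g _ ->]; have [] := hP g.
move=> _ _ /mapP[g _ ->] /mapP[g' _ ->] i.
have [[_ /(_ i) +] [_ /(_ i) +]] := (hP g, hP g').
rewrite !mxE !ler_norml => /andP[a1 a2] /andP[b1 b2].
have gL k : (k < L)%N -> k%:R * r + r <= L%:R * r.
  by move=> kL; rewrite -[X in _ + X]mul1r -mulrDl ler_wpM2r ?(ltW r0)// natr1 ler_nat.
have := gL _ (ltn_ord (g i)); have := gL _ (ltn_ord (g' i)).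
have : 0 <= r * (g i)%:R by rewrite mulr_ge0 ?(ltW r0).
have : 0 <= r * (g' i)%:R by rewrite mulr_ge0 ?(ltW r0).
lra.
Qed.

(** The lower limit is a supremum of infima over neighbourhoods of infinity, one of which is the
    half-line beyond [B]. *)
Lemma limf_einf_lt (f : R -> \bar R) (e B : R) :
  0 < e -> limf_einf f (pinfty_nbhs R) = 0%E ->
  exists2 T, B < T & (f T < e%:E)%E.
Proof.
move=> e0; rewrite limf_einfE => f0.
have : (ereal_inf (f @` [set T | (B < T)%R]) < e%:E)%E.
  apply: (@le_lt_trans _ _ 0%E); last by rewrite lte_fin.
  rewrite -f0; apply: ereal_sup_ubound; exists [set T | (B < T)%R] => //.
  by exists B; split; [exact: num_real|].
by move=> /ereal_inf_lt[_ [T BT <-] fT]; exists T.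
Qed.

(** One centre is chosen for each of the finitely many patterns. *)
Lemma pattern_representatives S (T : R) :
  (pattern_complexity S T < +oo)%E ->
  exists2 reps : seq 'rV[R]_d, pattern_complexity S T = (size reps)%:R%:E &
    forall s, S s -> exists2 s1, s1 \in reps &
      forall x, enorm x <= T -> S (s + x) <-> S (s1 + x).
Proof.
rewrite /pattern_complexity /counting; case: asboolP => // Pf _.
have /choice[h hP] : forall P, exists s, patterns S T P ->
    S s /\ translate S s `&` closed_eball 0 T = P.
  move=> P; have [[s Ss PE]|nP] := pselect (patterns S T P); first by exists s.
  by exists 0.
exists (map h (fset_set (patterns S T))); first by rewrite size_map.
move=> s Ss; pose P := translate S s `&` closed_eball 0 T.
have PP : patterns S T P by exists s.
have [Sh hPE] := hP _ PP; exists (h P).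
  by apply: map_f; rewrite in_fset_set// inE.
have trE s' x : enorm x <= T ->
    S (s' + x) <-> (translate S s' `&` closed_eball 0 T) x.
  rewrite /closed_eball /= subr0 => xT; split=> [Sx|[[y Sy <-] _]].
    by split => //; exists (s' + x) => //; rewrite addrC addKr.
  by rewrite addrC subrK.
by move=> x xT; rewrite !trE// hPE.
Qed.

End Cubes.

(** * Choice of the parameters and conclusion *)

Lemma meyer_int_annihilator (R : realType) (d : nat) (S : set 'rV[R]_d) :
  (0 < d)%N -> meyer S ->
  limf_einf (fun T : R => (pattern_complexity S T * (T ^- d)%:E)%E)
    (pinfty_nbhs R) = 0%E ->
  exists l : seq (int * 'rV[R]_d),
    [/\ l != [::], uniq (map snd l), {in l, forall x, x.1 != 0} &
      lincomb l (fun u => (u \in S)%:R) =1 cst 0].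
Proof.
move=> d0 [[_ [r r0 Sr]] [/uniformly_discrete_cube[e e0 Se] _]] S0.
have {}Sr x : exists2 s, S s & cube r (s - x).
  by have [s [Ss /cube_enorm sx]] := Sr x; exists s.
(* A cube of radius 3rL then holds at most (bL)^d points of S - S, and one of radius r at most
   b^d. *)
pose b := (Num.truncn (6 * r / e)).+1.
have rb : 6 * r / e < b%:R := truncnS_gt _.
(* The bound 2 (bL)^d b^d of [popular_translates], divided by the size L^d of [A]. *)
pose K := (2 * b ^ d * b ^ d)%N.
have K0 : (0 < K)%N by rewrite !muln_gt0 !expn_gt0.
(* The vectors w - v have coordinates at most r + 3rL <= 4rL, hence Euclidean norm at most qL <= T:
   the patterns of radius [T] see them. *)
have [q [q0 qE]] : exists q, 0 < q /\ q = 4 * d%:R * r.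
  by exists (4 * d%:R * r); rewrite !mulr_gt0 ?ltr0n.
(* Since T <= 2qL, the bound N_S(T) < eps T^d gives 2 K N_S(T) < L^d. *)
pose eps := (2 * K%:R * (2 * q) ^+ d)^-1.
have eps0 : 0 < eps by rewrite invr_gt0 !mulr_gt0 ?exprn_gt0 ?mulr_gt0 ?ltr0n.
have [T qT NT] := limf_einf_lt q eps0 S0.
have T0 : 0 < T := lt_trans q0 qT.
have [|reps Nreps repsP] := @pattern_representatives _ _ S T.
  rewrite ltey; apply: contraTneq NT => ->.
  by rewrite gt0_mulye ?lte_fin ?invr_gt0 ?exprn_gt0// -leNgt leey.
pose L := Num.truncn (T / q).
have Tq1 : 1 <= T / q by rewrite ler_pdivlMr// mul1r ltW.
have L0 : (0 < L)%N by rewrite truncn_gt0.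
have /andP[LT TL] : L%:R <= T / q < L.+1%:R.
  by rewrite truncn_itv// (le_trans _ Tq1).
have {}TL : T <= 2 * q * L%:R.
  have L1 : 1 <= L%:R :> R by rewrite ler1n.
  move: TL; rewrite ltr_pdivrMr// -natr1 => /ltW/le_trans; apply.
  by rewrite (_ : 2 * q * _ = 2 * L%:R * q); [rewrite ler_pM2r//; lra|ring].
rewrite ler_pdivlMr// in LT.
have NL : (2 * K * size reps < L ^ d)%N.
  move: NT; rewrite Nreps -EFinM lte_fin ltr_pdivrMr ?exprn_gt0//.
  rewrite mulrC ltr_pdivlMr ?mulr_gt0 ?exprn_gt0 ?mulr_gt0 ?ltr0n// => NT.
  have : T ^+ d <= (2 * q * L%:R) ^+ d.
    by rewrite lerXn2r// nnegrE ltW// !mulr_gt0 ?ltr0n.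
  move=> /(lt_le_trans NT); rewrite [ltRHS]exprMn [ltRHS]mulrC !mulrA.
  rewrite ltr_pM2r; last by rewrite exprn_gt0// mulr_gt0.
  by rewrite -natrX -!natrM ltr_nat -mulnA mulnC.
have [A [Au sA AS AA]] := cube_grid r0 Sr L0.
have diffS : {in differences A, forall v,
    difference_set S v /\ cube (3 * r * L%:R) v}.
  move=> v; rewrite mem_undup => /allpairsP[[x y] /= [xA yA ->]].
  by split; [exists x; [exact: AS|exists y => //; exact: AS]|exact: AA].
have sdiff : (size (differences A) <= (b * L) ^ d)%N.
  apply: (@cube_packing _ _ (difference_set S) e (3 * r * L%:R) _ 0) => //.
  - by rewrite !mulr_ge0// ltW.
  - rewrite natrM (_ : 2 * _ / e = 6 * r / e * L%:R); last by ring.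
    by rewrite ltr_pM2r// ltr0n.
  - exact: undup_uniq.
  - by move=> v /diffS[]; rewrite subr0.
have nA : (0 < size A)%N by rewrite sA expn_gt0 L0.
pose D := popular_differences A ((b * L) ^ d).
have DA v : v \in D -> cube (3 * r * L%:R) v.
  by rewrite mem_filter => /andP[_ /diffS[]].
apply: (@exists_int_annihilator _ S (cube r) D reps K).
- exact/filter_uniq/undup_uniq.
- by move=> u; have [s Ss su] := Sr u; exists s => // i; move: (su i); rewrite !mxE distrC.
- move=> s /repsP[s1 s1r s1P]; exists s1 => // w v wr /DA vr.
  rewrite -!addrA; apply: s1P; apply: le_trans LT.
  apply: le_trans (@enorm_cube _ _ _ (4 * r * L%:R) _ _) _.
  + by rewrite !mulr_ge0// ltW.
  + move=> i; rewrite !mxE (le_trans (ler_normB _ _))//.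
    apply: (le_trans (lerD (wr i) (vr i))).
    have : r <= r * L%:R by rewrite ler_pMr// ler1n.
    lra.
  + by rewrite le_eqVlt; apply/orP; left; apply/eqP; rewrite qE; ring.
- move=> s W Wu WP.
  have WK : (size W * size A <= 2 * (b * L) ^ d * b ^ d)%N.
    apply: (@popular_translates _ A ((b * L) ^ d) (b ^ d) S (cube r) s W) => //.
    move=> c P Pu PP; apply: (@cube_packing _ _ (difference_set S) e r _ c) => //.
    - exact: ltW.
    - by apply: le_lt_trans rb; rewrite ler_pM2r ?invr_gt0// ler_pM2r// ler_nat.
    move=> p /PP[pc [x Sx [y Sy pE]]]; split=> //.
    by exists x => //; exists y.
  rewrite -(@leq_pmul2r (L ^ d)) ?expn_gt0 ?L0// -sA (leq_trans WK)// sA.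
  by rewrite /K expnMn mulnA mulnAC.
(* The factor 2 comes from [D] having at least half as many elements as [A]. *)
rewrite -(@ltn_pmul2l 2)// mulnCA mulnC; apply: leq_trans NL _.
by rewrite -sA; apply: size_popular_differences.
Qed.

Theorem corollary5p5 (R : realType) (d : nat) (hd : (1 <= d)%N)
    (S : set 'rV[R]_d) (hS : meyer S)
    (hN : limf_einf (fun T : R => (pattern_complexity S T * (T ^- d)%:E)%E)
            (pinfty_nbhs R) = 0%E) :
  (exists2 f : rdpoly R d, f <> [fsfun] & annihilates_set f S) /\
  (exists (m : nat) (v : 'I_m -> 'rV[R]_d),
    [/\ (1 <= m)%N, forall i, v i <> 0
      & annihilates_set (prod_monomial_sub1 v) S]).
Proof.
have [l [l0 lu lnz lS]] := meyer_int_annihilator hd hS hN.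
have indE : (\1_S : 'rV[R]_d -> R[i]) = fun u => ((u \in S)%:R : int)%:~R.
  by apply/funext => u; rewrite indicE; case: (u \in S).
split.
  exists (int_rdpoly l).
    case: l l0 lu lnz lS => // x l _ lu lnz _ f0.
    have xl : x \in x :: l by rewrite inE eqxx.
    have := int_rdpolyE lu xl; rewrite f0 fsfun0E => /esym/eqP.
    by rewrite intr_eq0; apply/negP; exact: lnz.
  by move=> u; rewrite indE conv_int_rdpoly// lS.
have [s s0 sS] : exists2 s : seq 'rV[R]_d, 0 \notin s &
    foldr (@shift_diff _ _) (fun u => (u \in S)%:R : int) s =1 cst 0.
  case: l l0 lu lnz lS => // x l _ /= /andP[xl _] lnz lS.
  apply: (lincomb_annihilator_diff _ _ xl _ lS).
  - by move=> v n v0; rewrite -scaler_nat scaler_eq0 negb_or pnatr_eq0.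
  - by apply: lnz; rewrite inE eqxx.
  - by move=> u; case: (u \in S).
(* The extra factor X^e - 1, with [e] non-zero as d >= 1, makes the product non-empty even when [s]
   is empty. *)
pose e : 'rV[R]_d := const_mx 1.
have e0 : e != 0.
  apply/rV0Pn; exists (Ordinal hd); rewrite mxE; exact: oner_neq0.
exists (size (e :: s)), (fun i => (e :: s)`_i); split=> //.
  move=> i; apply/eqP; apply: contraNneq (s0) => ei0.
  have : (e :: s)`_i \in e :: s by apply: mem_nth.
  by rewrite ei0 inE eq_sym (negPf e0).
have es0 : 0 \notin e :: s by rewrite inE eq_sym (negPf e0).
move=> u; rewrite indE conv_prod_monomial_sub1// foldr_shift_diff_intr/=.
by rewrite /shift_diff !sS subrr.
Qed.
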